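(* For $k\in\mathbb Z/6\mathbb Z$ put $\mathbf v_k=\left(1,\cos\frac{2\pi k}{6},\sin\frac{2\pi k}{6}\right)\in\mathbb R^3$. Then for every $d\in\mathbb N$ it is impossible to have vectors $\mathbf a_0,\dots,\mathbf a_5\in\mathbb R^d_{\ge 0}$ with $\langle \mathbf a_j,\mathbf a_k\rangle=\langle\mathbf v_j,\mathbf v_k\rangle$ for all $j,k\in\mathbb Z/6\mathbb Z$.
   Context: $\mathbb R^d_{\ge 0}$ denotes the positive orthant of $\mathbb R^d$, i.e. the set of vectors all of whose coordinates are nonnegative; $\langle\cdot,\cdot\rangle$ is the standard inner product on $\mathbb R^d$, respectively $\mathbb R^3$. *)

(* Defs.v *)
From mathcomp Require Import all_boot all_order all_algebra.
From mathcomp Require Import reals trigo.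

Set Implicit Arguments.
Unset Strict Implicit.
Unset Printing Implicit Defensive.

Import Order.TTheory GRing.Theory Num.Theory.
Local Open Scope ring_scope.

(* The library's [dotmx] needs a numClosedFieldType (it conjugates), so it does
   not apply to real vectors. *)
Definition dotv (R : realType) (n : nat) (x y : 'rV[R]_n) : R :=
  \sum_(i < n) x 0 i * y 0 i.

Definition nonneg_orthant (R : realType) (n : nat) (x : 'rV[R]_n) : Prop :=
  forall i : 'I_n, 0 <= x 0 i.

(* The class k is represented by its canonical representative in {0, ..., 5};
   by periodicity of cos and sin the choice of representative is immaterial. *)
Definition hexv (R : realType) (k : 'Z_6) : 'rV[R]_3 :=
  let t : R := 2 * pi * (val k)%:R / 6 in
  \row_(i < 3) [:: 1; cos t; sin t]`_i.

(* Main.v *)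
Require Import Defs.
From mathcomp Require Import all_boot all_order all_algebra.
From mathcomp Require Import reals trigo.
From mathcomp Require Import ring lra.

(** The Gram matrix determines the linear relations, so the relations
    v_0 + v_3 = v_1 + v_4 = v_2 + v_5 and v_0 + v_2 + v_4 = v_1 + v_3 + v_5 also
    hold for the a_k. Since <v_k, v_(k+3)> = 0 and the a_k are nonnegative,
    a_k and a_(k+3) have disjoint supports. Fix a coordinate and let s be the
    common value of a_k + a_(k+3) there: each a_k is 0 or s, while
    a_0 + a_2 + a_4 = 3s/2, which forces s = 0. Hence a_0 = 0, contradicting
    <a_0, a_0> = 2. *)

Import Order.TTheory GRing.Theory Num.Theory.
Local Open Scope ring_scope.

Lemma dotv_sumZ (R : realType) (n : nat) (I : finType) (c : I -> R)
    (b : I -> 'rV[R]_n) :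
  dotv (\sum_k c k *: b k) (\sum_k c k *: b k) =
  \sum_j \sum_k c j * c k * dotv (b j) (b k).
Proof.
rewrite /dotv; under eq_bigr => i _.
  rewrite summxE big_distrlr /=.
  under eq_bigr => j _ do under eq_bigr => k _ do rewrite !mxE mulrACA.
  over.
rewrite exchange_big; apply: eq_bigr => j _.
by rewrite exchange_big; apply: eq_bigr => k _; rewrite mulr_sumr.
Qed.

Lemma dotv_eq0 (R : realType) (n : nat) (x : 'rV[R]_n) :
  dotv x x = 0 -> x = 0.
Proof.
move=> x0; apply/rowP => i; rewrite mxE.
have /(_ i isT)/eqP := psumr_eq0P (fun i _ => sqr_ge0 (x 0 i)) x0.
by rewrite sqrf_eq0 => /eqP.
Qed.

(** The squared norm of a linear combination is a quadratic form in its coefficients whose matrix is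
    the Gram matrix. Equal Gram matrices thus give equal norms, and only the zero vector has norm
    0. *)
Lemma gram_linear_relation (R : realType) (m n : nat) (I : finType)
    (a : I -> 'rV[R]_m) (b : I -> 'rV[R]_n) (c : I -> R) :
  (forall j k, dotv (a j) (a k) = dotv (b j) (b k)) ->
  \sum_k c k *: b k = 0 -> \sum_k c k *: a k = 0.
Proof.
move=> ab b0; apply: dotv_eq0; rewrite dotv_sumZ.
under eq_bigr => j _ do under eq_bigr => k _ do rewrite ab.
by rewrite -dotv_sumZ b0 /dotv big1 // => i _; rewrite mxE mul0r.
Qed.

(** The sign condition on the [a k] enters through this lemma only: nonnegative terms with sum 0 all
    vanish. *)
Lemma dotv_nonneg_eq0 (R : realType) (n : nat) (x y : 'rV[R]_n) :
  nonneg_orthant x -> nonneg_orthant y -> dotv x y = 0 ->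
  forall i, x 0 i * y 0 i = 0.
Proof.
by move=> x0 y0 xy i; apply: (psumr_eq0P _ xy) => // k _; apply: mulr_ge0.
Qed.

(** With x = pi/3, 2x = pi - x, so cos (2x) = - cos x. Together with cos^2 + sin^2 = 1 this is (2c -
    1)(c + 1) = 0 for c = cos x, and c > 0 selects the root 1/2. *)
Lemma cos_pi3 (R : realType) : cos (pi / 3) = 1 / 2 :> R.
Proof.
have pi0 := pi_gt0 R.
have c0 : 0 < cos (pi / 3) :> R by apply: cos_gt0_pihalf; apply/andP; split; lra.
have : cos (pi / 3 + pi / 3) = cos (- (pi / 3) + pi) :> R.
  by congr cos; field.
rewrite cosDpi cosN cosD.
have := cos2Dsin2 (pi / 3 : R); set c := cos _; set s := sin _ => cs dbl.
have /eqP : (2 * c - 1) * (c + 1) = 0.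
  have -> : (2 * c - 1) * (c + 1) = (c * c - s * s + c) + (c ^+ 2 + s ^+ 2 - 1).
    by ring.
  by rewrite cs dbl; ring.
by rewrite mulf_eq0 => /orP[] /eqP; rewrite -/c in c0 *; lra.
Qed.

Lemma sum_Z6 (V : nmodType) (F : 'Z_6 -> V) :
  \sum_k F k = F (inZp 0) + (F (inZp 1) + (F (inZp 2) +
               (F (inZp 3) + (F (inZp 4) + F (inZp 5))))).
Proof.
rewrite !big_ord_recl big_ord0 addr0.
by do 5?[congr (_ + _)]; congr F; apply: val_inj.
Qed.

Lemma hexv_dot (R : realType) (j k : 'Z_6) :
  dotv (hexv R j) (hexv R k) =
  1 + cos (2 * pi * (val j)%:R / 6 - 2 * pi * (val k)%:R / 6).
Proof.
by rewrite /dotv !big_ord_recl big_ord0 !mxE /= cosB mulr1 addr0.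
Qed.

Lemma hexv_dot_antipodal (R : realType) (k : nat) : (k < 3)%N ->
  dotv (hexv R (inZp k)) (hexv R (inZp (k + 3))) = 0.
Proof.
move=> k3; rewrite hexv_dot /= !modn_small; last 2 first.
- by rewrite (ltn_add2r 3 k 3).
- exact: ltn_trans k3 _.
rewrite natrD -cosN.
have -> : - (2 * pi * k%:R / 6 - 2 * pi * (k%:R + 3) / 6) = pi :> R by field.
by rewrite cospi subrr.
Qed.

(** The angles differ by pi, so the cosines and the sines cancel and only the constant first
    coordinate survives. *)
Lemma hexv_add_antipodal (R : realType) (k : nat) : (k < 3)%N ->
  hexv R (inZp k) + hexv R (inZp (k + 3)) = 2 *: delta_mx 0 0.
Proof.
move=> k3; apply/rowP => i; rewrite !mxE /= !modn_small; last 2 first.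
- by rewrite (ltn_add2r 3 k 3).
- exact: ltn_trans k3 _.
have -> : 2 * pi * (k + 3)%:R / 6 = 2 * pi * k%:R / 6 + pi :> R.
  by rewrite natrD; field.
rewrite cosDpi sinDpi.
by case: i => -[|[|[|//]]] i3 /=; rewrite ?subrr ?mulr0 ?mulr1.
Qed.

(** Writing e for [delta_mx 0 0], adding v_4 and using v_1 + v_4 = 2e gives v_0 + v_2 + v_4 = 3e.
    The three antipodal pairs sum to 6e, so v_1 + v_3 + v_5 = 3e as well. *)
Lemma hexv0_add_hexv2 (R : realType) :
  hexv R (inZp 0) + hexv R (inZp 2) = hexv R (inZp 1) + delta_mx 0 0.
Proof.
apply/rowP => i; rewrite !mxE /= !modn_small //.
have -> : 2 * pi * 0%:R / 6 = 0 :> R by rewrite mulr0 mul0r.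
have -> : 2 * pi * 1%:R / 6 = pi / 3 :> R by field.
have -> : 2 * pi * 2%:R / 6 = - (pi / 3) + pi :> R by field.
rewrite cosDpi sinDpi cosN sinN opprK cos0 sin0 cos_pi3.
by case: i => -[|[|[|//]]] i3 /=; rewrite ?add0r ?addr0 //; lra.
Qed.

Theorem theorem2p2 (R : realType) (d : nat) :
  ~ exists a : 'Z_6 -> 'rV[R]_d,
      (forall k : 'Z_6, nonneg_orthant (a k)) /\
      (forall j k : 'Z_6, dotv (a j) (a k) = dotv (hexv R j) (hexv R k)).
Proof.
move=> [a [a0 ag]].
have rel (s : seq R) i : \sum_(k : 'Z_6) s`_k *: hexv R k = 0 ->
    \sum_(k : 'Z_6) s`_k * a k 0 i = 0.
  move=> /(gram_linear_relation _ _ _ _ _ _ (fun k : 'Z_6 => s`_k) ag)/rowP/(_ i).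
  by rewrite summxE mxE; under eq_bigr do rewrite mxE.
have orth k : (k < 3)%N -> forall i, a (inZp k) 0 i * a (inZp (k + 3)) 0 i = 0.
  by move=> k3; apply: dotv_nonneg_eq0 => //; rewrite ag hexv_dot_antipodal.
suff a0E : a (inZp 0) = 0.
  have : dotv (a (inZp 0)) (a (inZp 0)) = 2 by rewrite ag hexv_dot subrr cos0.
  by rewrite a0E /dotv big1 => [|i _]; rewrite ?mxE ?mulr0 //; lra.
have [r1 r2 r3] : [/\ forall i, a (inZp 0) 0 i + a (inZp 3) 0 i
                              = a (inZp 1) 0 i + a (inZp 4) 0 i,
    forall i, a (inZp 0) 0 i + a (inZp 3) 0 i
            = a (inZp 2) 0 i + a (inZp 5) 0 i &
    forall i, a (inZp 0) 0 i + a (inZp 2) 0 i + a (inZp 4) 0 i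
            = a (inZp 1) 0 i + a (inZp 3) 0 i + a (inZp 5) 0 i].
  have h := hexv0_add_hexv2 R.
  have h0 := @hexv_add_antipodal R 0 isT.
  have h1 := @hexv_add_antipodal R 1 isT.
  have h2 := @hexv_add_antipodal R 2 isT.
  (* Coefficients of the three relations, stacked in reverse so that they are introduced in the
     order of the goals. *)
  have := rel [:: 1; -1; 1; -1; 1; -1].
  have := rel [:: 1; 0; -1; 1; 0; -1].
  have := rel [:: 1; -1; 0; 1; -1; 0].
  rewrite !sum_Z6 /=; move: h h0 h1 h2; rewrite /addn /=.
  (* Once the v_k are arbitrary vectors, no cosine or sine is left and the relations are linear in
     coordinates. *)
  move: (hexv R (inZp 0)) (hexv R (inZp 1)) (hexv R (inZp 2)) (hexv R (inZp 3))
    (hexv R (inZp 4)) (hexv R (inZp 5)) => v0 v1 v2 v3 v4 v5.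
  move=> /rowP h /rowP h0 /rowP h1 /rowP h2 r1 r2 r3.
  split=> i; [move: (r1 i)|move: (r2 i)|move: (r3 i)];
    (* The premise of each relation is replaced by 0 = 0; that the combination of the v_k is 0 is
       left to the bullets. *)
    rewrite sum_Z6 [X in X = 0 -> _](_ : _ = 0) /=;
    try by move=> /(_ erefl); lra.
  - by apply/rowP => j; move: (h0 j) (h1 j); rewrite !mxE; lra.
  - by apply/rowP => j; move: (h0 j) (h2 j); rewrite !mxE; lra.
  - by apply/rowP => j; move: (h j) (h0 j) (h1 j) (h2 j); rewrite !mxE; lra.
apply/rowP => i; rewrite [RHS]mxE.
move: (r1 i) (r2 i) (r3 i) (orth 0 isT i) (orth 1 isT i) (orth 2 isT i).
rewrite /addn /= => e1 e2 e3.
(* Eight cases: in each, a_0 + a_2 + a_4 is m * s with m an integer, so it equals 3s/2 only if s =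
   0. *)
by do 3?[move=> /eqP; rewrite mulf_eq0 => /orP[]/eqP ?]; lra.
Qed.
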